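(* Let $p\in(0,1)$, $q=1-p$, $n\ge1$. Let $(\varepsilon_1,\dots,\varepsilon_{n-1})$ be the shelf word of an asymmetric single-shelf shuffle of $n$ cards with parameter $p$ ($\varepsilon_j=1$ if card $j$ is placed at the top of the pile, $\varepsilon_j=0$ otherwise), and let $X_n$ be the number of correct guesses under the optimal strategy in the complete feedback game played on the resulting deck. For $0<p<\frac12$ put $\nu=\lfloor\log p/\log(1-p)\rfloor+1$. For a binary word $w$ let $R_0(w)$ be the number of zero-runs (maximal blocks of consecutive zeros) in $w$. (1) If $p\ge\frac12$, then $n-X_n=R_0(\varepsilon_1,\ldots,\varepsilon_{n-1})$. In particular, $n-X_n$ has the law of the number of zero-runs in a Bernoulli$(p)$ word of length $n-1$. (2) If $0<p<\frac12$ and $1\le n\le\nu$, then $n-X_n=\sum_{j=1}^{n-1}\varepsilon_j$. In particular, $n-X_n$ has the $\mathrm{Bin}(n-1,p)$ distribution. (3) If $0<p<\frac12$ and $n>\nu$, set $a=n-\nu$ and $\tau=\min\{j\in\{a,a+1,\ldots,n-1\}:\varepsilon_j=1\}$, with $\tau=n$ if this set is empty. Then \[ n-X_n=R_0(\varepsilon_1,\ldots,\varepsilon_a)+\sum_{j=\tau+1}^{n-1}\varepsilon_j, \] where the second term is $0$ when $\tau=n$.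
   Context: Asymmetric single-shelf shuffle with parameter $p\in(0,1)$: start with an ordered deck of $n$ cards labelled $1,\dots,n$ (card $1$ on top). Cards are drawn one at a time from the bottom of the deck (card $n$ first, card $1$ last) and placed in a pile; independently, each drawn card is placed at the top of the pile with probability $p$ and at the bottom with probability $1-p$. Thus $\varepsilon_1,\dots,\varepsilon_{n-1}$ are independent Bernoulli$(p)$, and the shuffled deck read from the top consists of the cards $j\le n-1$ with $\varepsilon_j=1$ in increasing order, then card $n$, then the cards with $\varepsilon_j=0$ in decreasing order. Complete feedback game: the player guesses the cards of the shuffled deck sequentially from the top; after each guess the card is shown and removed. Optimal strategy used: let $j$ be the label of the last card shown ($j=0$ before the first guess). As long as neither card $n$ nor card $n-1$ has been shown: if $p\ge\frac12$, guess $j+1$; if $p<\frac12$, guess $n$ when $n-j\le\nu$ and guess $j+1$ when $n-j>\nu$. Once card $n$ or $n-1$ has been shown, guess the remaining cards in decreasing order. $X_n=X_n(p)$ denotes the number of correct guesses under this strategy. *)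

(* Defs.v *)
From HB Require Import structures.
From mathcomp Require Import all_boot all_order all_algebra.
From mathcomp Require Import all_classical all_reals all_analysis.

Set Implicit Arguments.
Unset Strict Implicit.
Unset Printing Implicit Defensive.
Import Order.TTheory GRing.Theory Num.Theory.
Local Open Scope classical_set_scope.
Local Open Scope ring_scope.

Section Shelf.
Local Open Scope nat_scope.

(* The word eps_1 ... eps_m is stored as a sequence indexed from 0, whereas
   cards and letters are numbered from 1. *)
Definition shelf (w : seq bool) (j : nat) : bool := nth false w j.-1.

(* Card n starts the pile; then cards n-1, ..., 1 (foldr consumes the list
   from its right end) go on top or at the bottom. The head of the sequence is
   the top of the deck. *)
Definition shuffled_deck (n : nat) (w : seq bool) : seq nat :=
  foldr (fun j pile => if shelf w j then j :: pile else rcons pile j)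
        [:: n] (iota 1 n.-1).

Lemma shuffled_deckE n w :
  shuffled_deck n w = [seq j <- iota 1 n.-1 | shelf w j] ++
    n :: rev [seq j <- iota 1 n.-1 | ~~ shelf w j].
Proof.
rewrite /shuffled_deck; elim: (iota 1 n.-1) => //= j s ->.
by case: (shelf w j) => //=; rewrite rev_cons -cats1 -catA /= cats1.
Qed.

(* A strategy maps the cards shown so far, oldest first, to the next guess. *)
Definition correct_guesses (guess : seq nat -> nat) (deck : seq nat) : nat :=
  \sum_(i < size deck) (guess (take i deck) == nth 0 deck i).

Lemma size_shuffled_deck n w : 0 < n -> size (shuffled_deck n w) = n.
Proof.
move=> n0; rewrite shuffled_deckE size_cat /= size_rev addnS !size_filter.
by rewrite count_predC size_iota prednK.
Qed.

Lemma correct_guesses_le guess deck : correct_guesses guess deck <= size deck.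
Proof.
rewrite -[leqRHS]card_ord -sum1_card /correct_guesses.
by apply: leq_sum => i _; case: (_ == _).
Qed.

Definition zero_block (w : seq bool) (B : {set 'I_(size w)}) : bool :=
  [exists i : 'I_(size w), exists j : 'I_(size w),
     (i <= j) && (B == [set k : 'I_(size w) | i <= k <= j]%SET)]
  && [forall k in B, ~~ nth false w k].

Definition zero_runs (w : seq bool) : nat :=
  #|[set B | maxset (@zero_block w) B]%SET|.

(* The minimum of the set, and n when it is empty, as minn j n = j for j < n. *)
Definition first_one (a n : nat) (w : seq bool) : nat :=
  \big[minn/n]_(a <= j < n | shelf w j) j.

End Shelf.

Section Strategy.
Context {R : realType}.
Variables (p : R) (n : nat).

(* For 0 < p < 1 the quotient is positive, so truncn is the floor. *)
Definition nu : nat := (Num.truncn (ln p / ln (1 - p))).+1.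

Definition optimal_guess (shown : seq nat) : nat :=
  let j := last 0%N shown in
  if (n \notin shown) && (n.-1 \notin shown) then
    if 2^-1 <= p then j.+1
    else if (n - j <= nu)%N then n else j.+1
  else (\max_(c <- iota 1 n | c \notin shown) c)%N.

Definition num_correct (w : seq bool) : nat :=
  correct_guesses optimal_guess (shuffled_deck n w).

End Strategy.

Section BernoulliWord.
Context {R : realType}.

Definition mutually_independent d d' (T : measurableType d)
    (T' : measurableType d') (P : probability T R) (m : nat)
    (X : 'I_m -> {RV P >-> T'}) : Prop :=
  forall (J : {set 'I_m}) (B : 'I_m -> set T'),
    (forall i, measurable (B i)) ->
    P (\bigcap_(i in [set` J]) (X i @^-1` B i)) =
    (\prod_(i in J) P (X i @^-1` B i))%E.

Definition is_bernoulli_word d (T : measurableType d) (P : probability T R)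
    (p : R) (m : nat) (eps : 'I_m -> {RV P >-> bool}) : Prop :=
  (forall i, distribution P (eps i) = bernoulli_prob p :> (set bool -> \bar R))
  /\ mutually_independent eps.

Definition word d (T : measurableType d) (P : probability T R) (m : nat)
    (eps : 'I_m -> {RV P >-> bool}) (t : T) : m.-tuple bool :=
  [tuple eps i t | i < m].

(* The product measure Bernoulli(p)^m on words of length m. *)
Definition bernoulli_word_prob (p : R) (m : nat) (A : set (m.-tuple bool)) :
    \bar R :=
  (\sum_(w : m.-tuple bool | w \in A)
     \prod_(i < m) bernoulli_pmf p (tnth w i))%:E.

End BernoulliWord.

(* Main.v *)
Require Import Defs.
From HB Require Import structures.
From mathcomp Require Import all_boot all_order all_algebra.
From mathcomp Require Import all_classical all_reals all_analysis.
From mathcomp Require Import zify.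

Set Implicit Arguments.
Unset Strict Implicit.
Unset Printing Implicit Defensive.
Import Order.TTheory GRing.Theory Num.Theory.
Local Open Scope classical_set_scope.
Local Open Scope ring_scope.

(** Since [n] guesses are made, [n - X_n] is the number of wrong guesses,
    counted by [misses]. The optimal strategy is, on every sublist of the deck,
    one of the strategies [threshold_guess n a]: after a last card [j], guess
    [j + 1] if [j < a] and [n] otherwise, until card [n] or [n - 1] appears. The
    threshold is [a = n - 1] when [p >= 1/2] and [a = n - nu] (truncated) when
    [p < 1/2], so the three cases of the theorem are three readings of one count.

    The deck is: the ones in increasing order, then [n], then the zeros in
    decreasing order. Once [n] has been shown every guess is right, so misses
    occur only at ones and at [n] ([threshold_misses_deck]). A one [i <= a] is
    missed exactly when card [i - 1] is a zero, that is, when a zero-run ends at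
    [i - 1]; every one [i > a] is missed. If [a > 0], then [n] is missed exactly
    when no one [i >= a] came before it, while for [a = 0] it never is
    ([threshold_missesE]). So for [a = 0] the misses are the ones.

    Let [a > 0]. Counting zero-runs by their last letters ([zero_runsE]), the
    misses at ones [i <= a] are the zero-runs of [eps_1 ... eps_a] that end
    before [a]. If [eps_a = 0], one more run ends at [a]; it is paid for by the
    miss at the first one [tau > a], or by the miss at [n] if there is no such
    one. What remains is one miss for each one after [tau] ([threshold_misses]).

    The laws follow because independence gives every word its product weight
    ([probability_word]), and the words with [k] ones all have weight
    [p^k (1-p)^(m-k)] and are in bijection with the [k]-subsets of [m]
    positions ([bernoulli_word_count]). *)

(** * Zero-runs counted by their last letters *)

Section ZeroRuns.
Variable w : seq bool.
Local Open Scope nat_scope.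
Local Notation m := (size w).

(** The default [true] makes a zero in the last position the end of a run. *)
Definition run_end (k : nat) : bool := ~~ nth false w k && nth true w k.+1.

Definition zeros_upto (k : 'I_m) : {set 'I_m} :=
  [set i : 'I_m | (i <= k) &&
    [forall l : 'I_m, (i <= l <= k) ==> ~~ nth false w l]]%SET.

Lemma zeros_uptoP (k i : 'I_m) :
  reflect (i <= k /\ forall l : 'I_m, i <= l <= k -> ~~ nth false w l)
    (i \in zeros_upto k).
Proof.
rewrite inE; apply: (iffP andP) => -[ik /= H]; split=> //.
  by move=> l; exact/implyP/(forallP H).
by apply/forallP => l; exact/implyP/H.
Qed.

Lemma zeros_upto_self (k : 'I_m) : ~~ nth false w k -> k \in zeros_upto k.
Proof.
move=> wk; apply/zeros_uptoP; split=> // l.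
by rewrite -eqn_leq => /eqP /ord_inj <-.
Qed.

Lemma zero_block_zeros_upto (k : 'I_m) :
  ~~ nth false w k -> zero_block (zeros_upto k).
Proof.
move=> wk; have kk := zeros_upto_self wk; apply/andP; split.
  case: (arg_minnP (fun i : 'I_m => val i) kk) => i ik imin.
  apply/existsP; exists i; apply/existsP; exists k.
  have [lik zik] := zeros_uptoP _ _ ik.
  rewrite lik; apply/eqP/setP => l; rewrite [RHS]inE; apply/idP/andP.
    by move=> lk; split; [exact: imin | case/zeros_uptoP: lk].
  move=> [il lk]; apply/zeros_uptoP; split=> // x /andP[lx xk].
  by apply: zik; rewrite xk (leq_trans il).
apply/forall_inP => l /zeros_uptoP[lk]; apply.
by rewrite leqnn lk.
Qed.

Lemma zero_blockP (B : {set 'I_m}) : zero_block B ->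
  exists i j : 'I_m, [/\ i <= j, forall k, (k \in B) = (i <= k <= j) &
    forall k : 'I_m, i <= k <= j -> ~~ nth false w k].
Proof.
move=> /andP[/existsP[i /existsP[j /andP[ij /eqP defB]]] /forall_inP zB].
exists i, j; split=> // k; first by rewrite defB inE.
by move=> ikj; apply: zB; rewrite defB inE.
Qed.

Lemma zero_block_interval (i j : 'I_m) : i <= j ->
  (forall k : 'I_m, i <= k <= j -> ~~ nth false w k) ->
  zero_block [set k : 'I_m | i <= k <= j]%SET.
Proof.
move=> ij z; apply/andP; split; last first.
  by apply/forall_inP => k; rewrite inE; exact: z.
by apply/existsP; exists i; apply/existsP; exists j; rewrite ij /= eqxx.
Qed.

(** An interval of zeros containing a run end [k] cannot go beyond [k], where
    the next letter is a one. *)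
Lemma maxset_zeros_upto (k : 'I_m) :
  run_end k -> maxset (@zero_block w) (zeros_upto k).
Proof.
move=> /andP[wk wk1]; apply/maxsetP; split; first exact: zero_block_zeros_upto.
move=> B /zero_blockP[i [j [ij memB zB]]] sB.
have kB : k \in B by apply: (fintype.subsetP sB); exact: zeros_upto_self.
move: (kB); rewrite memB => /andP[ik kj].
have jk : j <= k.
  rewrite leqNgt; apply/negP => kj'.
  have km : k.+1 < m by apply: leq_trans (ltn_ord j).
  have := zB (Ordinal km); rewrite /= kj' (leq_trans ik)// => /(_ isT).
  by rewrite (set_nth_default true)// wk1.
apply/setP => x; apply/idP/idP; last exact: (fintype.subsetP sB).
rewrite memB => /andP[ix xj]; apply/zeros_uptoP; split.
  exact: leq_trans jk.
by move=> l /andP[xl lk]; apply: zB; rewrite (leq_trans ix xl) (leq_trans lk kj).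
Qed.

(** The last position of a maximal block ends a run: otherwise the block could
    be extended by the next position. *)
Lemma maxset_zero_block_run_end (B : {set 'I_m}) :
  maxset (@zero_block w) B -> exists2 k : 'I_m, run_end k & B = zeros_upto k.
Proof.
move=> /maxsetP[/zero_blockP[i [j [ij memB zB]]] maxB].
have wj : ~~ nth false w j by apply: zB; rewrite ij /=.
exists j.
  rewrite /run_end wj /=; have [jm|jm] := ltnP j.+1 m; last by rewrite nth_default.
  rewrite (set_nth_default false)//; apply/negP => wj1.
  have ij1 : i <= Ordinal jm by rewrite /= leqW.
  have zC (k : 'I_m) : i <= k <= Ordinal jm -> ~~ nth false w k.
    rewrite /= => /andP[ik]; rewrite leq_eqVlt => /predU1P[->|].
      exact/negP.
    by rewrite ltnS => kj; apply: zB; rewrite ik.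
  have := maxB _ (zero_block_interval ij1 zC).
  have sB : B \subset [set k : 'I_m | i <= k <= Ordinal jm]%SET.
    by apply/fintype.subsetP => k; rewrite memB inE /= => /andP[-> /leqW].
  move=> /(_ sB) /setP /(_ (Ordinal jm)).
  by rewrite memB inE /= ltnn leqnn andbF andbT leqW.
apply/esym/maxB; first exact: zero_block_zeros_upto.
apply/fintype.subsetP => k; rewrite memB => /andP[ik kj].
apply/zeros_uptoP; split=> //.
by move=> l /andP[kl lj]; apply: zB; rewrite (leq_trans ik kl).
Qed.

(** [zeros_upto] is a bijection from run ends to maximal blocks; it is
    injective since [k] is the largest position of [zeros_upto k]. *)
Lemma zero_runsE : zero_runs w = \sum_(0 <= k < m) run_end k.
Proof.
rewrite big_mkord -big_mkcond /= sum1_card.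
rewrite /zero_runs -(@card_in_imset _ _ zeros_upto (fun k : 'I_m => run_end k)).
  apply: eq_card => B; rewrite inE; apply/idP/imsetP.
    by move=> /maxset_zero_block_run_end[k rk ->]; exists k.
  by move=> [k rk ->]; exact: maxset_zeros_upto.
move=> k l /andP[wk _] /andP[wl _] kl; apply/val_inj/eqP.
rewrite eqn_leq; apply/andP; split.
  by have := zeros_upto_self wk; rewrite kl => /zeros_uptoP[].
by have := zeros_upto_self wl; rewrite -kl => /zeros_uptoP[].
Qed.

End ZeroRuns.

(** * Wrong guesses along a deck *)

Section Misses.
Local Open Scope nat_scope.
Implicit Types (guess : seq nat -> nat) (s r deck : seq nat).

(** The cards [s] already shown are kept as an argument so that the count can
    be cut at any point of the deck ([misses_cat]). *)
Fixpoint misses guess s r : nat :=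
  if r is c :: r' then (guess s != c) + misses guess (rcons s c) r' else 0.

Lemma misses_cat guess s r1 r2 :
  misses guess s (r1 ++ r2) = misses guess s r1 + misses guess (s ++ r1) r2.
Proof.
elim: r1 s => [|c r1 IH] s /=; first by rewrite cats0.
by rewrite IH addnA -cats1 -catA.
Qed.

Lemma size_sub_correct_guesses guess deck :
  size deck - correct_guesses guess deck = misses guess [::] deck.
Proof.
suff H r s : \sum_(i < size r) (guess (s ++ take i r) == nth 0 r i) +
    misses guess s r = size r.
  by rewrite -(H deck [::]) addKn.
elim: r s => [|c r IH] s; first by rewrite big_ord0.
rewrite big_ord_recl /= cats0 addnACA.
under eq_bigr do rewrite -cat_rcons.
by rewrite IH; case: (_ == _).
Qed.

Lemma eq_misses guess guess' s r :
  (forall s', {subset s' <= s ++ r} -> guess s' = guess' s') ->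
  misses guess s r = misses guess' s r.
Proof.
elim: r s => //= c r IH s H; rewrite H ?IH// => [s'|x xs].
  by rewrite cat_rcons; exact: H.
by rewrite mem_cat xs.
Qed.

(** * Threshold strategies *)

Definition threshold_guess (n a : nat) (s : seq nat) : nat :=
  if (n \notin s) && (n.-1 \notin s) then
    if last 0 s < a then (last 0 s).+1 else n
  else \max_(c <- iota 1 n | c \notin s) c.

(** The largest unshown card is the head of the remaining deck when the latter
    is decreasing. *)
Lemma misses_descending n a s r :
  perm_eq (s ++ r) (iota 1 n) -> sorted gtn r ->
  (n \in s) || (n.-1 \in s) -> misses (threshold_guess n a) s r = 0.
Proof.
elim: r s => //= c r IH s sr cr ns.
rewrite IH ?cat_rcons ?(path_sorted cr) ?mem_rcons ?inE//; last first.
  by case/orP: ns => ->; rewrite !orbT.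
rewrite addn0 /threshold_guess -negb_or ns /=.
suff -> : \max_(x <- iota 1 n | x \notin s) x = c by rewrite eqxx.
have mi x : (x \in iota 1 n) = (x \in s ++ c :: r) by rewrite (perm_mem sr).
have us : uniq (s ++ c :: r) by rewrite (perm_uniq sr) iota_uniq.
apply/eqP; rewrite eqn_leq; apply/andP; split.
  apply/bigmax_leqP_seq => x; rewrite mi mem_cat inE => /orP[->//|].
  move=> /predU1P[->//|xr] _.
  have /allP/(_ _ xr) := order_path_min (rev_trans ltn_trans) cr.
  exact: ltnW.
apply: leq_bigmax_seq; first by rewrite mi mem_cat mem_head orbT.
by apply: contraTN us => cs; rewrite cat_uniq /= cs andbF.
Qed.

(** The cards shown before card [i] when [i] is a one or [i = n]. *)
Definition ones_below (e : pred nat) (i : nat) : seq nat :=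
  [seq k <- iota 1 i.-1 | e k].

Lemma iota1S m : iota 1 m.+1 = iota 1 m ++ [:: m.+1].
Proof. by rewrite -[RHS](iotaD 1 m 1) addn1. Qed.

Lemma ones_belowS e i :
  0 < i -> ones_below e i.+1 = if e i then rcons (ones_below e i) i
                               else ones_below e i.
Proof.
case: i => // i _; rewrite /ones_below iota1S filter_cat /=.
by case: (e _); rewrite ?cats0 ?cats1.
Qed.

Lemma mem_ones_below e i k :
  (k \in ones_below e i) = [&& e k, 0 < k & k < i].
Proof. by rewrite mem_filter mem_iota; case: i => [|i]; case: k => //=; lia. Qed.

Lemma last_ones_below_lt e i : 0 < i -> last 0 (ones_below e i) < i.
Proof.
move=> i0; have := mem_last 0 (ones_below e i).
by rewrite inE mem_ones_below => /predU1P[->//|/and3P[]].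
Qed.

Lemma last_ones_below_has e i a : 0 < a -> 0 < i ->
  (last 0 (ones_below e i) < a) = ~~ has e (index_iota a i).
Proof.
move=> a0; case: i => // i _; elim: i => [|i IH].
  by rewrite /ones_below /= a0 /index_iota (eqP a0).
rewrite ones_belowS//.
have [ai|ia] := leqP a i.+1; last first.
  rewrite /index_iota (_ : i.+2 - a = 0) ?(eqP ia)//=.
  case: ifP => _; rewrite ?last_rcons//.
  by apply: ltn_trans ia; apply: last_ones_below_lt.
have -> : index_iota a i.+2 = index_iota a i.+1 ++ [:: i.+1].
  by rewrite /index_iota subSn// -[(_ - _).+1]addn1 iotaD subnKC.
rewrite has_cat /= orbF negb_or.
by rewrite -IH; case: (e i.+1); rewrite ?last_rcons ?andbT// andbF ltnNge ai.
Qed.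

Lemma misses_ones guess e m :
  misses guess [::] [seq k <- iota 1 m | e k] =
  \sum_(1 <= i < m.+1 | e i) (guess (ones_below e i) != i).
Proof.
elim: m => [|m IH]; first by rewrite big_nil.
rewrite iota1S filter_cat misses_cat IH [RHS]big_mkcond.
by rewrite big_nat_recr// -big_mkcond /=; case: (e _); rewrite /= ?addn0.
Qed.

Lemma shuffled_deck_ones_below n w :
  shuffled_deck n w = ones_below (shelf w) n ++
    n :: rev [seq j <- iota 1 n.-1 | ~~ shelf w j].
Proof. exact: shuffled_deckE. Qed.

Lemma perm_shuffled_deck n w : 0 < n -> perm_eq (shuffled_deck n w) (iota 1 n).
Proof.
case: n => // n _; rewrite shuffled_deckE iota1S perm_sym perm_catC perm_sym.
rewrite -cat1s perm_catCA perm_cat2l /=.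
apply: perm_trans (permEl (perm_filterC (shelf w) _)).
by rewrite perm_cat2l perm_rev.
Qed.

Lemma max_unshown n s : 0 < n -> n \notin s ->
  \max_(c <- iota 1 n | c \notin s) c = n.
Proof.
move=> n0 ns; apply/eqP; rewrite eqn_leq; apply/andP; split.
  by apply/bigmax_leqP_seq => x; rewrite mem_iota add1n ltnS => /andP[].
by apply: leq_bigmax_seq => //; rewrite mem_iota n0 add1n ltnSn.
Qed.

Section Threshold.
Variables (n a : nat) (w : seq bool).
Hypothesis an : a < n.
Local Notation e := (shelf w).
Let n0 : 0 < n. Proof. exact: leq_ltn_trans an. Qed.

(** From [n] on the rest of the deck is decreasing and card [n] has been shown,
    so the zeros contribute nothing. *)
Lemma threshold_misses_deck :
  misses (threshold_guess n a) [::] (shuffled_deck n w) =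
  \sum_(1 <= i < n | e i) (threshold_guess n a (ones_below e i) != i) +
  (threshold_guess n a (ones_below e n) != n).
Proof.
rewrite shuffled_deck_ones_below misses_cat misses_ones prednK// /=.
rewrite misses_descending ?addn0//.
- by rewrite cat_rcons -shuffled_deck_ones_below perm_shuffled_deck.
- rewrite rev_sorted; apply: sorted_filter; first exact: ltn_trans.
  exact: iota_ltn_sorted.
- by rewrite mem_rcons mem_head.
Qed.

(** Before card [i <= a] the last card shown is below [a], so the guess is the
    successor of the largest one below [i], which is [i] exactly when [i = 1] or
    [i - 1] is a one. Before [i > a] the guess is either at most [a] or
    equal to [n]. *)
Lemma threshold_miss_one i : 0 < i < n ->
  (threshold_guess n a (ones_below e i) != i) =
  (a < i) || (1 < i) && ~~ e i.-1.
Proof.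
move=> /andP[i0 i_n]; rewrite /threshold_guess !mem_ones_below.
have -> : n < i = false by lia.
have -> : n.-1 < i = false by lia.
rewrite !andbF /=; have li := last_ones_below_lt e i0.
have [ai|ia] := ltnP a i.
  by case: ifP => [la|_] /=; rewrite neq_ltn ?i_n ?orbT// (leq_trans _ ai).
rewrite (leq_trans li ia) /=.
case: i i0 {i_n ia} li => // -[|i] _ // _ /=.
rewrite ones_belowS//; case: ifP => ei; first by rewrite last_rcons eqxx.
by have := last_ones_below_lt e (ltn0Sn i); lia.
Qed.

(** If [n - 1] has been shown, the guess is the largest unshown card, which is
    [n]; this agrees with the general criterion, since the last card shown is then
    [n - 1 >= a]. *)
Lemma threshold_miss_top :
  (threshold_guess n a (ones_below e n) != n) = (last 0 (ones_below e n) < a).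
Proof.
rewrite /threshold_guess.
have nn : n \notin ones_below e n by rewrite mem_ones_below ltnn !andbF.
rewrite nn /=; case: ifPn => [_|].
  by case: ifP => la; rewrite ?eqxx// neq_ltn (leq_ltn_trans la an).
rewrite max_unshown// eqxx negbK => n1; apply/esym/negbTE; rewrite -leqNgt.
move: n1; rewrite mem_ones_below => /and3P[en1 n10 _].
case: n an en1 n10 {nn} => // -[//|k] ak ek _.
by rewrite ones_belowS// ek last_rcons.
Qed.

Lemma threshold_missesE :
  misses (threshold_guess n a) [::] (shuffled_deck n w) =
  \sum_(1 <= i < a.+1 | e i) ((1 < i) && ~~ e i.-1) +
  \sum_(a.+1 <= i < n) e i + (last 0 (ones_below e n) < a).
Proof.
rewrite threshold_misses_deck threshold_miss_top; congr (_ + _).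
rewrite (big_cat_nat (n := a.+1))//=; congr (_ + _).
  rewrite big_nat_cond [RHS]big_nat_cond.
  apply: eq_bigr => i /andP[/andP[i0 ia] ei].
  rewrite threshold_miss_one ?i0 ?(leq_ltn_trans _ an)//.
  by rewrite ltnNge -ltnS ia.
rewrite big_mkcond; apply: eq_big_nat => i /andP[ai i_n].
have i0n : 0 < i < n by rewrite (leq_trans _ ai).
by rewrite threshold_miss_one// ai; case: (e i).
Qed.

End Threshold.

(** * Threshold misses in terms of zero-runs and the first one *)

Lemma first_one_ge a n w : a <= n -> a <= first_one a n w.
Proof.
move=> an; rewrite /first_one big_seq_cond.
apply: (@big_ind _ (fun x => a <= x)) => // [x y ax ay|j].
  by rewrite leq_min ax.
by rewrite mem_index_iota; case/andP => /andP[].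
Qed.

Lemma first_one_lt_has a n w : a <= n ->
  (first_one a n w < n) = has (shelf w) (index_iota a n).
Proof.
move=> an; move: {2}(n - a) (erefl (n - a)) => k; elim: k a an => [|k IH] a an E.
  by rewrite /first_one /index_iota E big_nil ltnn.
have a_n : a < n by rewrite -subn_gt0 E.
rewrite /index_iota E /= -[k]/(k.+1.-1) -E -subnS -/(index_iota _ _).
rewrite -IH// ?subnS ?E// /first_one big_ltn_cond//.
by case: (shelf w a) => //=; rewrite gtn_min a_n.
Qed.

(** When it exists, the first one is the only one in the range that the sum
    after it leaves out. *)
Lemma sum_after_first_one a n w : a <= n ->
  (first_one a n w < n) + \sum_((first_one a n w).+1 <= j < n) shelf w j =
  \sum_(a <= j < n) shelf w j.
Proof.
move=> an; move: {2}(n - a) (erefl (n - a)) => k; elim: k a an => [|k IH] a an E.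
  have -> : a = n by lia.
  by rewrite /first_one !big_geq// ltnn.
have a_n : a < n by rewrite -subn_gt0 E.
have {}IH := IH a.+1 a_n; rewrite [RHS]big_ltn// -IH ?subnS ?E//.
rewrite [first_one a n w]/first_one big_ltn_cond// -/(first_one _ _ _).
case: (shelf w a) => //=.
have /minn_idPl -> : a <= first_one a.+1 n w by apply/ltnW/first_one_ge.
by rewrite a_n IH// subnS E.
Qed.

(** A run of [take a w] ends either just before a one [i <= a] or at [a]. *)
Lemma zero_runs_take a w : 0 < a -> a <= size w ->
  zero_runs (take a w) =
  \sum_(1 <= i < a.+1 | shelf w i) ((1 < i) && ~~ shelf w i.-1) + ~~ shelf w a.
Proof.
case: a => // b _ bw.
have st : size (take b.+1 w) = b.+1 by rewrite size_takel.
rewrite zero_runsE st big_nat_recr//= {2}/run_end nth_take//.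
rewrite [nth true _ _]nth_default ?st// andbT; congr (_ + _).
rewrite [RHS]big_mkcond [RHS]big_nat_recl//= if_same add0n.
rewrite big_add1 /=; apply: eq_big_nat => i /= ib.
rewrite /run_end !nth_take ?ltnS//; last exact: ltnW.
rewrite (set_nth_default false); last exact: leq_trans bw.
rewrite -/(shelf w i.+2) -/(shelf w i.+1).
by case: (shelf w i.+2); rewrite ?andbT ?andbF.
Qed.

(** If [a] is a one, it is the first one [tau]. If not, the run that ends at [a]
    in [take a w] accounts for the miss at [tau], or for the miss at card [n]
    when all cards from [a] to [n - 1] are zeros. *)
Lemma threshold_misses n a w : size w = n.-1 -> 0 < a -> a < n ->
  misses (threshold_guess n a) [::] (shuffled_deck n w) =
  zero_runs (take a w) + \sum_((first_one a n w).+1 <= j < n) shelf w j.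
Proof.
move=> sw a0 an; rewrite threshold_missesE// zero_runs_take//; last first.
  by rewrite sw -ltnS (ltn_predK an).
rewrite last_ones_below_has ?(leq_ltn_trans _ an)//.
rewrite -(first_one_lt_has _ (ltnW an)).
have := sum_after_first_one w (ltnW an); rewrite [X in _ = X -> _](big_ltn an).
case: (shelf w a); case: (first_one a n w < n) => /=;
  move: (\sum_((first_one a n w).+1 <= j < n) _) (\sum_(a.+1 <= j < n) _)
    (\sum_(1 <= i < _ | _) _) => S1 S2 Q; lia.
Qed.

Lemma threshold0_misses n w : 0 < n ->
  misses (threshold_guess n 0) [::] (shuffled_deck n w) =
  \sum_(1 <= j < n) shelf w j.
Proof.
by move=> n0; rewrite threshold_missesE// ltn0 addn0 big_geq// add0n.
Qed.

End Misses.

(** * The optimal strategy as a threshold strategy *)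

Section OptimalStrategy.
Context {R : realType}.
Variables (p : R) (n : nat).
Hypothesis n0 : (0 < n)%N.

Lemma misses_optimal w : (n - num_correct p n w)%N =
  misses (optimal_guess p n) [::] (shuffled_deck n w).
Proof. by rewrite -size_sub_correct_guesses size_shuffled_deck. Qed.

Lemma optimal_guess_lt_half s : p < 2^-1 ->
  optimal_guess p n s = threshold_guess n (n - nu p) s.
Proof.
rewrite ltNge => /negbTE p2; rewrite /optimal_guess /threshold_guess p2.
case: ifP => // _; case: leqP => H; case: ltnP => // H'; lia.
Qed.

(** With threshold [n - 1] the two strategies could only differ after a last
    card [n - 1] or more, when [n - 1] or [n] has been shown; for [n = 1]
    and nothing shown, both guess [1]. *)
Lemma optimal_guess_ge_half s : 2^-1 <= p -> {in s, forall c, (c <= n)%N} ->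
  optimal_guess p n s = threshold_guess n n.-1 s.
Proof.
rewrite /optimal_guess /threshold_guess => -> sn.
case: ifP => // /andP[ns n1s]; case: ltnP => // nj.
have := mem_last 0%N s; rewrite inE => /predU1P[j0|js].
  by move: nj; rewrite j0; lia.
have jn := sn _ js.
have [jn1|jn1] := ltnP n.-1 (last 0%N s).
  have jE : last 0%N s = n by apply/eqP; rewrite eqn_leq jn -(prednK n0).
  by rewrite -jE js in ns.
have jE : last 0%N s = n.-1 by apply/eqP; rewrite eqn_leq jn1.
by rewrite -jE js in n1s.
Qed.

Lemma misses_lt_half w : p < 2^-1 -> (n - num_correct p n w)%N =
  misses (threshold_guess n (n - nu p)) [::] (shuffled_deck n w).
Proof.
move=> p2; rewrite misses_optimal; apply: eq_misses => s _.
exact: optimal_guess_lt_half.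
Qed.

Lemma misses_ge_half w : 2^-1 <= p -> (n - num_correct p n w)%N =
  misses (threshold_guess n n.-1) [::] (shuffled_deck n w).
Proof.
move=> p2; rewrite misses_optimal; apply: eq_misses => s sD.
apply: optimal_guess_ge_half => // c /sD /=.
by rewrite (perm_mem (perm_shuffled_deck w n0)) mem_iota => /andP[].
Qed.

Lemma misses_zero_runs w : 2^-1 <= p -> size w = n.-1 ->
  (n - num_correct p n w)%N = zero_runs w.
Proof.
move=> p2 sw; rewrite misses_ge_half//.
have nn : (n.-1 < n)%N by rewrite prednK.
(* For [n = 1] the threshold is 0; the deck is a single card. *)
have [n1|n1] := posnP n.-1.
  by rewrite n1 threshold0_misses// zero_runsE sw n1 !big_geq// -(prednK n0) n1.
(* The first one from [n - 1] on is at least [n - 1], so no one follows it. *)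
rewrite threshold_misses// take_oversize ?sw// big_geq ?addn0//.
by rewrite -{1}(prednK n0) ltnS first_one_ge// ltnW.
Qed.

Lemma misses_count w : p < 2^-1 -> (n <= nu p)%N ->
  (n - num_correct p n w)%N = (\sum_(1 <= j < n) shelf w j)%N.
Proof.
by move=> p2 nnu; rewrite misses_lt_half// (eqP nnu) threshold0_misses.
Qed.

Lemma misses_zero_runs_count w : p < 2^-1 -> (nu p < n)%N -> size w = n.-1 ->
  (n - num_correct p n w)%N =
  (zero_runs (take (n - nu p) w) +
   \sum_((first_one (n - nu p) n w).+1 <= j < n) shelf w j)%N.
Proof.
move=> p2 nun sw; rewrite misses_lt_half// threshold_misses// ?subn_gt0//.
by rewrite ltn_subrL n0.
Qed.

Lemma sum_shelf w : size w = n.-1 ->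
  (\sum_(1 <= j < n) shelf w j)%N = count id w.
Proof.
move=> sw; rewrite big_add1 -sw /shelf /= -sum1_count.
rewrite [RHS](big_nth false) [RHS]big_mkcond.
by apply: eq_bigr => i _; case: nth.
Qed.

End OptimalStrategy.

(** * The law of the shelf word *)

Section BernoulliWordLaw.
Context {R : realType} {d : measure_display} {T : measurableType d}.
Variables (P : probability T R) (p : R) (m : nat).
Variable eps : 'I_m -> {RV P >-> bool}.
Hypotheses (p01 : 0 <= p <= 1) (bern : is_bernoulli_word p eps).

Lemma word_preimage (w : m.-tuple bool) :
  [set t | word eps t = w] =
  \bigcap_(i in [set` [set: 'I_m]%SET]) (eps i @^-1` [set tnth w i]).
Proof.
apply/seteqP; split=> t /=.
  by move=> <- i _ /=; rewrite tnth_mktuple.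
move=> H; apply/eq_from_tnth => i; rewrite tnth_mktuple.
by apply: H; rewrite /= inE.
Qed.

Lemma measurable_word (w : m.-tuple bool) :
  measurable [set t | word eps t = w].
Proof.
rewrite word_preimage; apply: fin_bigcap_measurable => // i _.
exact: measurable_funPTI.
Qed.

Lemma probability_word (w : m.-tuple bool) :
  P [set t | word eps t = w] = (\prod_(i < m) bernoulli_pmf p (tnth w i))%:E.
Proof.
have [law indep] := bern.
rewrite word_preimage indep// -prodEFin.
apply: eq_big => [i|i _]; first by rewrite inE.
have := congr1 (fun mu => mu [set tnth w i]) (law i).
rewrite /distribution /pushforward /= => ->.
by rewrite /bernoulli_prob p01 fsbig_set1.
Qed.

Lemma word_law (B : set (m.-tuple bool)) :
  P [set t | B (word eps t)] = bernoulli_word_prob p B.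
Proof.
have -> : [set t | B (word eps t)] =
    \bigcup_(w in [set` [pred w | w \in B]]) [set t | word eps t = w].
  apply/seteqP; split=> t /=.
    by move=> Bt; exists (word eps t) => //=; rewrite !inE.
  by move=> [w /= + wt]; rewrite !inE wt.
rewrite measure_fin_bigcup//; last 2 first.
  by move=> w w' _ _ [t [/= -> ->]].
  by move=> w _; exact: measurable_word.
rewrite /bernoulli_word_prob -sumEFin.
(* Both sides become sums over the same list of words. *)
rewrite -[RHS]big_filter [RHS]fsbig_seq ?filter_uniq ?index_enum_uniq//=.
rewrite (_ : [set` [pred w in B]] =
    [set` [seq w <- index_enum _ | w \in B]]); last first.
  by apply/seteqP; split=> w /=; rewrite mem_filter mem_index_enum andbT.
by apply: eq_fsbigr => w _; exact: probability_word.
Qed.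

End BernoulliWordLaw.

(** * The number of ones of a Bernoulli word *)

Section BinomialLaw.
Context {R : realType}.
Variables (p : R) (m : nat).

Lemma prod_bernoulli_pmf (w : m.-tuple bool) :
  \prod_(i < m) bernoulli_pmf p (tnth w i) =
  p ^+ count id w * (1 - p) ^+ (m - count id w).
Proof.
under eq_bigr do rewrite (tnth_nth false).
rewrite -(big_mkord xpredT (fun i => bernoulli_pmf p (nth false w i))).
move: (size_tuple w); move: (tval w) => s <-.
rewrite -(big_nth false xpredT) -(count_predC id) addKn /=.
elim: s => [|b s IH]; first by rewrite big_nil mulr1.
rewrite big_cons IH; case: b; rewrite /= ?add1n ?add0n exprS ?mulrA//.
by rewrite [_ * p ^+ _]mulrC.
Qed.

(** A word is the indicator of its set of ones. *)
Lemma card_count_tuple k :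
  #|[set w : m.-tuple bool | count id w == k]%SET| = 'C(m, k).
Proof.
rewrite -[in RHS](card_ord m) -card_draws.
pose f (w : m.-tuple bool) : {set 'I_m} := [set i | tnth w i]%SET.
have fK : cancel f (fun A => [tuple i \in A | i < m]).
  by move=> w; apply/eq_from_tnth => i; rewrite tnth_mktuple inE.
rewrite -(card_imset _ (can_inj fK)); apply: eq_card => A; rewrite inE.
have gK : cancel (fun A : {set 'I_m} => [tuple i \in A | i < m]) f.
  by move=> B; apply/setP => i; rewrite inE tnth_mktuple.
rewrite -[in LHS](gK A) (mem_imset _ _ (can_inj fK)) inE.
by rewrite /= count_map -size_filter cardE [enum A]/enum_mem -enumT.
Qed.

Lemma bernoulli_word_count (p01 : 0 <= p <= 1) (A : set nat) :
  bernoulli_word_prob p [set w : m.-tuple bool | A (count id w)] =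
  binomial_prob m p A.
Proof.
have [p0 p1] := andP p01.
rewrite (@binomial_probE R m p p0 p1) /bernoulli_word_prob.
have cm (w : m.-tuple bool) : (count id w < m.+1)%N.
  by rewrite ltnS -[leqRHS](size_tuple w) count_size.
rewrite (partition_big (fun w : m.-tuple bool => Ordinal (cm w)) xpredT)//=.
rewrite -sumEFin; apply: eq_bigr => k _.
rewrite diracE -EFinM; congr (_%:E).
under eq_bigr do rewrite prod_bernoulli_pmf.
rewrite (eq_big (fun w : m.-tuple bool => (val k \in A) && (count id w == k))
  (fun=> p ^+ k * (1 - p) ^+ (m - k))); last 2 first.
- move=> w; rewrite -val_eqE /=; case: (eqVneq (count id w) k) => [wk|_].
    by rewrite !andbT; apply/idP/idP; rewrite !inE /= wk.
  by rewrite !andbF.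
- by move=> w /andP[_ /eqP <-].
case: (val k \in A) => /=; last by rewrite big_pred0// mulr0.
rewrite mulr1 sumr_const; congr (_ *+ _); rewrite -card_count_tuple.
by apply: eq_card => w; rewrite !inE.
Qed.

End BinomialLaw.

Theorem corollary2 (R : realType) (p : R) (n : nat)
    (d : measure_display) (T : measurableType d) (P : probability T R)
    (eps : 'I_n.-1 -> {RV P >-> bool}) :
  0 < p < 1 -> (1 <= n)%N -> is_bernoulli_word p eps ->
  [/\ 2^-1 <= p ->
        (forall t : T,
           (n - num_correct p n (word eps t))%N = zero_runs (word eps t)) /\
        (forall A : set nat,
           P [set t | A (n - num_correct p n (word eps t))%N] =
           bernoulli_word_prob p [set w : n.-1.-tuple bool | A (zero_runs w)]),
      p < 2^-1 -> (n <= nu p)%N ->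
        (forall t : T,
           (n - num_correct p n (word eps t))%N =
           (\sum_(1 <= j < n) shelf (word eps t) j)%N) /\
        (forall A : set nat,
           P [set t | A (n - num_correct p n (word eps t))%N] =
           binomial_prob n.-1 p A)
    & p < 2^-1 -> (nu p < n)%N ->
        forall t : T,
          let a := (n - nu p)%N in
          let tau := first_one a n (word eps t) in
          (n - num_correct p n (word eps t))%N =
          (zero_runs (take a (word eps t)) +
           \sum_(tau.+1 <= j < n) shelf (word eps t) j)%N].
Proof.
move=> /andP[p0 p1] n1 bern.
have p01 : 0 <= p <= 1 by rewrite !ltW.
have sw t : size (word eps t) = n.-1 by rewrite size_tuple.
split=> [p2|p2 nnu|p2 nun t]; last exact: misses_zero_runs_count (sw t).
- have E t := misses_zero_runs n1 p2 (sw t).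
  split=> // A; rewrite -(word_law p01 bern).
  by under eq_set do rewrite E.
- have E t := misses_count n1 (word eps t) p2 nnu.
  split=> // A; rewrite -(bernoulli_word_count _ p01) -(word_law p01 bern).
  by under eq_set do rewrite E (sum_shelf (sw _)).
Qed.
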